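(* Let $Y$ be a topological vector space, $C\subset Y$ a non-trivial closed convex pointed cone, $k\in\operatorname{core}C$, and $a\in Y$. Denote by $\|\cdot\|_{C,k}$ the norm which is given as the Minkowski functional of the order interval $[-k,k]_C$. Then $$\|y-a\|_{C,k}=\varphi_{a-C,k}(y)\quad\forall y\in a+C.$$
   Context: Vector spaces are real. A set $C$ is a cone if $\lambda c\in C$ for all $\lambda\ge0$, $c\in C$; it is non-trivial if $C\neq\{0\}$ and $C\neq Y$ (and nonempty), and pointed if $C\cap(-C)=\{0\}$. $\operatorname{core}C$ is the algebraic interior of $C$. The order is $y^1\le_Cy^2\iff y^2-y^1\in C$, and $[-k,k]_C=\{y\in Y\mid-k\le_Cy\le_Ck\}=(C-k)\cap(k-C)$. The Minkowski functional of a set $M\subseteq Y$ is $p_M(y)=\inf\{\lambda>0\mid y\in\lambda M\}$; under the stated assumptions the Minkowski functional of $[-k,k]_C$ is a norm. $\varphi_{a-C,k}(y)=\inf\{t\in\mathbb{R}\mid y\in tk+(a-C)\}$, where $a-C=\{a-c\mid c\in C\}$. *)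

(* Defs.v *)
From HB Require Import structures.
From mathcomp Require Import all_boot all_order all_algebra.
From mathcomp Require Import all_classical all_reals all_analysis.

Set Implicit Arguments.
Unset Strict Implicit.
Unset Printing Implicit Defensive.

Import Order.TTheory GRing.Theory Num.Theory.

Local Open Scope classical_set_scope.
Local Open Scope ring_scope.

Section cones.
Context {R : realType} {Y : lmodType R}.
Implicit Types (C M A : set Y) (a k u y : Y).

Definition cone C := forall (l : R) c, 0 <= l -> C c -> C (l *: c).

Definition nontrivial C := [/\ C !=set0, C <> [set 0] & C <> setT].

Definition pointed C := C `&` [set - c | c in C] = [set 0].

Definition core M : set Y :=
  [set u | forall v : Y, exists2 e : R, 0 < e &
             forall l : R, 0 <= l <= e -> M (u + l *: v)].

Definition cone_le C (y1 y2 : Y) : Prop := C (y2 - y1).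

(* [-k, k]_C *)
Definition order_interval C k : set Y :=
  [set y | cone_le C (- k) y /\ cone_le C y k].

(* The infima below are taken in the extended reals; inf set0 = +oo. *)
Definition minkowski M y : \bar R :=
  ereal_inf [set l%:E | l in [set l : R | 0 < l /\ [set l *: m | m in M] y]].

(* phi_{A,k} *)
Definition gerstewitz A k y : \bar R :=
  ereal_inf [set t%:E | t in [set t : R | [set t *: k + z | z in A] y]].

(* ||.||_{C,k}; finiteness and the norm axioms are proved below for a closed,
   convex, pointed cone C and k in core C. *)
Definition cone_norm C k : Y -> \bar R := minkowski (order_interval C k).

End cones.

Section cone_norm_is_norm.
Context {R : realType} {Y : topologicalLmodType R}.
Variables (C : set Y) (k : Y).
Hypotheses (C_closed : closed C)
  (C_convex : convex_set (C : set (convex_lmodType Y))) (C_cone : cone C)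
  (C_pointed : pointed C) (C_core : core C k).

Let addC x y : C x -> C y -> C (x + y).
Proof.
move=> Cx Cy; have h0 : 0 <= (2^-1 : R) by rewrite invr_ge0.
have h1 : (2^-1 : R) <= 1 by rewrite invf_le1 ?ler1n ?ltr0n.
have := C_convex (Itv01 h0 h1) (mem_set Cx) (mem_set Cy).
rewrite inE => /(C_cone (ler0n _ 2)); congr C.
rewrite /conv /= /unstable.onem scalerDr !scalerA mulrBr mulr1 mulfV ?pnatr_eq0//.
have -> : 2 - 1 = 1 :> R by rewrite -[2]/(1 + 1) addrK.
by rewrite !scale1r.
Qed.

Let k_in : C k.
Proof.
have [e e0 /(_ 0)] := C_core 0.
by rewrite lexx ltW// scale0r addr0; exact.
Qed.

Let lev y := [set l : R | 0 < l /\ (C (l *: k + y) /\ C (l *: k - y))].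

Let cone_normE y : cone_norm C k y = ereal_inf [set l%:E | l in lev y].
Proof.
rewrite /cone_norm /minkowski; congr ereal_inf; congr (_ @` _).
apply/seteqP; split => l /= [l0].
  move=> [m [m1 m2] <-]; split=> //; split.
    by rewrite -scalerDr addrC -[k]opprK; exact: C_cone (ltW l0) m1.
  by rewrite -scalerBr; exact: C_cone (ltW l0) m2.
move=> [y1 y2]; split=> //; exists (l^-1 *: y); last first.
  by rewrite scalerA mulfV ?gt_eqF// scale1r.
have li : 0 <= l^-1 by rewrite invr_ge0 ltW.
have hk : k = l^-1 *: (l *: k) by rewrite scalerA mulVf ?gt_eqF// scale1r.
split; rewrite /cone_le.
  by rewrite opprK addrC hk -scalerDr; exact: C_cone li y1.
by rewrite hk -scalerBr; exact: C_cone li y2.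
Qed.

Let lev_up y l m : lev y l -> l <= m -> lev y m.
Proof.
move=> [l0 [y1 y2]] lm; split; first exact: lt_le_trans l0 lm.
have Cml : C ((m - l) *: k) by apply: C_cone => //; rewrite subr_ge0.
have -> : m *: k = (m - l) *: k + l *: k by rewrite scalerBl subrK.
by split; rewrite -addrA; exact: addC.
Qed.

Let lev_ex y : exists l, lev y l.
Proof.
have one v : exists2 l : R, 0 < l & C (l *: k + v).
  have [e e0 /(_ e)] := C_core v; rewrite lexx (ltW e0) => /(_ isT) Ce.
  exists e^-1; first by rewrite invr_gt0.
  have ei : 0 <= e^-1 by rewrite invr_ge0 ltW.
  by have := C_cone ei Ce; rewrite scalerDr scalerA mulVf ?gt_eqF// scale1r.
have [l l0 yl] := one y; have [m m0 ym] := one (- y).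
exists (l + m); split; first exact: addr_gt0.
split; rewrite scalerDl.
  by rewrite addrAC addrC; apply: addC => //; exact: C_cone (ltW m0) k_in.
by rewrite -addrA; apply: addC => //; exact: C_cone (ltW l0) k_in.
Qed.

Let norm_le y l : lev y l -> (cone_norm C k y <= l%:E)%E.
Proof. by move=> yl; rewrite cone_normE; apply: ereal_inf_lbound; exists l. Qed.

Let norm_lt y e : (cone_norm C k y < e%:E)%E -> lev y e.
Proof.
rewrite cone_normE => /ereal_inf_lt[_ [l yl <-]]; rewrite lte_fin => le.
exact: lev_up yl (ltW le).
Qed.

Lemma cone_norm_ge0 y : (0 <= cone_norm C k y)%E.
Proof.
rewrite cone_normE; apply: le_ereal_inf_tmp => _ [l [l0 _] <-].
by rewrite lee_fin ltW.
Qed.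

Lemma cone_norm_fin_num y : cone_norm C k y \is a fin_num.
Proof.
have [l yl] := lev_ex y.
rewrite ge0_fin_numE ?cone_norm_ge0//.
by apply: le_lt_trans (norm_le yl) _; rewrite ltry.
Qed.

Lemma cone_norm_eq0 y : cone_norm C k y = 0%E -> y = 0.
Proof.
move=> y0; have small e : 0 < e -> lev y e.
  by move=> e0; apply: norm_lt; rewrite y0 lte_fin.
have lim v : (forall e : R, 0 < e -> C (e *: k + v)) -> C v.
  move=> Cv; apply: (@closed_cvg _ _ (0 : R)^'+ _ (fun e : R => e *: k + v) C) => //.
    by near=> e; apply: Cv; near: e; exact: nbhs_right_gt.
  apply: cvg_at_right_filter; rewrite -[X in _ --> X]add0r -(scale0r k).
  have sk : (fun e : R => e *: k) @ nbhs (0 : R^o) --> nbhs ((0 : R) *: k).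
    apply: (@cvg_comp _ _ _ (fun e : R => (e : R^o, k)) (fun z : R^o * Y => z.1 *: z.2)
      _ (nbhs ((0 : R^o, k) : R^o * Y))).
      by apply: (@cvg_pair _ _ _ _ (nbhs (0 : R^o)) (nbhs k)); [exact: cvg_id|exact: cvg_cst].
    exact: (@scale_continuous _ _ (0 : R^o, k)).
  apply: (@cvg_comp _ _ _ (fun e : R => (e *: k, v)) (fun z : Y * Y => z.1 + z.2)
      _ (nbhs ((0 *: k, v) : Y * Y))).
    by apply: (@cvg_pair _ _ _ _ (nbhs ((0 : R) *: k)) (nbhs v)); [exact: sk|exact: cvg_cst].
  exact: (@add_continuous _ (0 *: k, v)).
have : (C `&` [set - c | c in C]) y.
  split; first by apply: lim => e /small[_ []].
  by exists (- y); [apply: lim => e /small[_ []]|rewrite opprK].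
by rewrite C_pointed.
Unshelve. all: by end_near. Qed.

Lemma cone_normD x y :
  (cone_norm C k (x + y) <= cone_norm C k x + cone_norm C k y)%E.
Proof.
have px := fineK (cone_norm_fin_num x); have py := fineK (cone_norm_fin_num y).
apply/lee_addgt0Pr => e e0; have e2 : 0 < e / 2 by rewrite divr_gt0.
have [a0 [a1 a2]] : lev x (fine (cone_norm C k x) + e / 2).
  by apply: norm_lt; rewrite -{1}px lte_fin ltrDl.
have [b0 [b1 b2]] : lev y (fine (cone_norm C k y) + e / 2).
  by apply: norm_lt; rewrite -{1}py lte_fin ltrDl.
have -> : (cone_norm C k x + cone_norm C k y + e%:E)%E =
    ((fine (cone_norm C k x) + e / 2) + (fine (cone_norm C k y) + e / 2))%:E.
  by rewrite -px -py -!EFinD addrACA -splitr.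
apply: norm_le; split; first exact: addr_gt0.
by split; rewrite scalerDl ?opprD addrACA; exact: addC.
Qed.

Lemma cone_normZ r y : cone_norm C k (r *: y) = (`|r|%:E * cone_norm C k y)%E.
Proof.
have pos s v : 0 < s -> cone_norm C k (s *: v) = (s%:E * cone_norm C k v)%E.
  move=> s0; rewrite !cone_normE -ereal_inf_pZl//; congr ereal_inf.
  have si : 0 <= s^-1 by rewrite invr_ge0 ltW.
  have sK (u : Y) : s^-1 *: (s *: u) = u by rewrite scalerA mulVf ?gt_eqF// scale1r.
  apply/seteqP; split => [_ [l [l0 [l1 l2]] <-]|_ [_ [l [l0 [l1 l2]] <-] <-]].
    exists (s^-1 * l)%:E; last by rewrite -EFinM mulrA mulfV ?mul1r// gt_eqF.
    exists (s^-1 * l) => //; split; first by rewrite mulr_gt0// invr_gt0.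
    split; rewrite -scalerA -[v]sK -?scalerBr -?scalerDr; exact: C_cone.
  exists (s * l) => //; split; first exact: mulr_gt0.
  by split; rewrite -scalerA -?scalerBr -?scalerDr; apply: C_cone => //; exact: ltW.
have opp v : cone_norm C k (- v) = cone_norm C k v.
  rewrite !cone_normE; congr ereal_inf; congr (_ @` _).
  by apply/seteqP; split => l [l0 [l1 l2]]; split=> //; split;
    rewrite ?opprK // -[v]opprK.
have [r0|r0|->] := ltgtP r 0.
- by rewrite -opp -scaleNr pos ?oppr_gt0// ltr0_norm.
- by rewrite pos// gtr0_norm.
rewrite scale0r normr0 mul0e; apply/eqP; rewrite eq_le cone_norm_ge0 andbT.
apply/lee_addgt0Pr => e e0; rewrite add0e; apply: norm_le; split=> //.
by rewrite subr0 addr0; split; exact: C_cone (ltW e0) k_in.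
Qed.

End cone_norm_is_norm.

(* Main.v *)
Require Import Defs.
From mathcomp Require Import all_boot all_order all_algebra.
From mathcomp Require Import all_classical all_reals all_analysis.

(** Write [y = a + d] with [d] in [C].  Both sides are infima of sets of
    scalars: by [scaled_order_interval] the norm of [d] is the infimum of the
    [l > 0] with [l k + d] and [l k - d] in [C], while by
    [translated_cone_shift] the right-hand side is the infimum of the real [t]
    with [t k - d] in [C].  Since [d] and [k] lie in [C], the condition on
    [l k + d] holds for every [l >= 0], so the two sets can only differ in their
    nonpositive elements.  Negative [t] cannot occur ([scale_core_sub_ge0]): they
    would put [-k] in [C], which forces the cone to be the whole space because
    [k] is an algebraic interior point.  The value [t = 0] does belong to the
    second set when [d = 0], but this leaves the infimum unchanged, as then
    every [e > 0] belongs to the first set. *)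

Import Order.TTheory GRing.Theory Num.Theory.

Local Open Scope classical_set_scope.
Local Open Scope ring_scope.

Section ConvexCone.
Context {R : realType} {Y : lmodType R}.
Implicit Types (C : set Y) (a d k v x y : Y) (l t : R).

(** The sum is twice the midpoint. *)
Lemma convex_cone_add C x y :
  convex_set (C : set (convex_lmodType Y)) -> cone C ->
  C x -> C y -> C (x + y).
Proof.
move=> C_convex C_cone Cx Cy.
have half_ge0 : 0 <= (2^-1 : R) by rewrite invr_ge0.
have half_le1 : (2^-1 : R) <= 1 by rewrite invf_le1 ?ler1n ?ltr0n.
have := C_convex _ _ (Itv01 half_ge0 half_le1) (mem_set Cx) (mem_set Cy).
rewrite inE => /(C_cone _ _ (ler0n _ 2)); congr C.
rewrite /conv /= /unstable.onem scalerDr !scalerA mulrBr mulr1.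
by rewrite mulfV ?pnatr_eq0// -[2]/(1 + 1) addrK !scale1r.
Qed.

Lemma core_sub C k : core C k -> C k.
Proof.
move=> /(_ 0)[e e0 /(_ 0)].
by rewrite lexx ltW// scale0r addr0; exact.
Qed.

Lemma cone_scale_inv C l v : cone C -> 0 < l -> C (l *: v) -> C v.
Proof.
move=> C_cone l0 Clv; have li : 0 <= l^-1 by rewrite invr_ge0 ltW.
by have := C_cone _ _ li Clv; rewrite scalerA mulVf ?gt_eqF// scale1r.
Qed.

(** For every [v] some [k + e v] with [e > 0] lies in the cone; adding [-k]
    and rescaling gives [v]. *)
Lemma core_opp_cone_setT C k :
  convex_set (C : set (convex_lmodType Y)) -> cone C ->
  core C k -> C (- k) -> C = setT.
Proof.
move=> C_convex C_cone C_core CNk; apply/seteqP; split=> // v _.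
have [e e0 /(_ e)] := C_core v; rewrite lexx ltW// => /(_ isT) Ckev.
apply: (cone_scale_inv _ _ _ C_cone e0).
by rewrite -(addKr k (e *: v)); exact: convex_cone_add.
Qed.

(** For [t < 0], adding [d] to [t k - d] and rescaling would show that [-k]
    lies in the cone. *)
Lemma scale_core_sub_ge0 C k d t :
  convex_set (C : set (convex_lmodType Y)) -> cone C -> C <> setT ->
  core C k -> C d -> C (t *: k - d) -> 0 <= t.
Proof.
move=> C_convex C_cone CnT C_core Cd Ctkd; rewrite leNgt; apply/negP => t0.
apply: CnT; apply: (core_opp_cone_setT _ k) => //.
have Nt0 : 0 < - t by rewrite oppr_gt0.
apply: (cone_scale_inv _ _ _ C_cone Nt0).
by rewrite scalerN scaleNr opprK -(subrK d (t *: k)); exact: convex_cone_add.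
Qed.

Lemma scaled_order_interval C k y l : cone C -> 0 < l ->
  [set l *: m | m in order_interval C k] y <->
  C (l *: k + y) /\ C (l *: k - y).
Proof.
move=> C_cone l0; split.
  move=> [m [Ckm Cmk] <-]; rewrite -scalerDr -scalerBr; split.
    by apply: C_cone (ltW l0) _; rewrite addrC -[k]opprK.
  exact: C_cone (ltW l0) Cmk.
have ly : l *: (l^-1 *: y) = y by rewrite scalerA mulfV ?gt_eqF// scale1r.
move=> [Cp Cm]; exists (l^-1 *: y) => //.
split; apply: (cone_scale_inv _ _ _ C_cone l0).
  by rewrite opprK addrC scalerDr ly.
by rewrite scalerBr ly.
Qed.

Lemma translated_cone_shift C k a d t :
  [set t *: k + z | z in [set a - c | c in C]] (a + d) <-> C (t *: k - d).
Proof.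
split.
  move=> [_ [c Cc <-]]; rewrite addrCA => /addrI <-.
  by rewrite opprB addrC subrK.
move=> Ctkd; exists (a - (t *: k - d)); first by exists (t *: k - d).
by rewrite addrCA opprB subrKC.
Qed.

End ConvexCone.

Theorem proposition19 (R : realType) (Y : topologicalLmodType R)
    (C : set Y) (k a : Y) :
  nontrivial C -> closed C -> convex_set (C : set (convex_lmodType Y)) ->
  cone C -> pointed C ->
  core C k ->
  forall y : Y, [set a + c | c in C] y ->
    cone_norm C k (y - a) = gerstewitz [set a - c | c in C] k y.
Proof.
move=> [_ _ CnT] _ C_convex C_cone _ C_core _ [d Cd <-].
have Ck := core_sub _ _ C_core.
rewrite addrAC subrr add0r /cone_norm /Defs.minkowski /gerstewitz.
apply/eqP; rewrite eq_le; apply/andP; split; apply: le_ereal_inf_tmp.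
  move=> _ [t /translated_cone_shift Ctkd <-].
  have t0 : 0 <= t by exact: scale_core_sub_ge0 Ctkd.
  (* The slack [e] covers [t = 0], which the first set excludes. *)
  apply/lee_addgt0Pr => e e0; rewrite -EFinD.
  have te0 : 0 < t + e by rewrite ltr_wpDl.
  apply: ereal_inf_lbound; exists (t + e) => //; split=> //.
  apply/scaled_order_interval => //; split.
    by apply: convex_cone_add => //; apply: C_cone => //; exact: ltW.
  rewrite scalerDl addrAC; apply: convex_cone_add => //.
  by apply: C_cone => //; exact: ltW.
move=> _ [l [l0 /scaled_order_interval] + <-].
move=> /(_ C_cone l0)[_ Clkd]; apply: ereal_inf_lbound; exists l => //.
exact/translated_cone_shift.
Qed.
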